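(* Let $\Delta=\Delta(p)$ be a function of the prime $p$ with $\Delta(p)\to\infty$ as $p\to\infty$. Then the set $$\{qy\pmod p:\ 1\le q\le p^{1/2},\ q\text{ prime},\ 1\le y\le \Delta\, p^{1/2}\log p\}$$ (with $y$ an integer) contains $(1+O(\Delta^{-1}))\,p$ residue classes modulo $p$.
   Context: The statement is asymptotic as the prime $p\to\infty$ (i.e. for all sufficiently large $p$), and the constant implied by $O$ does not depend on $p$. *)

(* Defs.v *)
From HB Require Import structures.
From mathcomp Require Import all_boot all_order all_algebra.
From mathcomp Require Import all_classical all_reals all_analysis.
Set Implicit Arguments.
Unset Strict Implicit.
Unset Printing Implicit Defensive.
Import Order.TTheory GRing.Theory Num.Theory.
Import numFieldNormedType.Exports.
Local Open Scope classical_set_scope.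
Local Open Scope ring_scope.

(* The filter "p tends to infinity through the primes". *)
Definition primes_oo : set_system nat := within [set p : nat | prime p] \oo.

(* The residue classes modulo p of the products q * y, with q prime,
   1 <= q <= p^(1/2) and 1 <= y <= D p^(1/2) log p; the type 'F_p is the ring
   Z/pZ because p is only ever prime here. *)
Definition product_classes (R : realType) (p : nat) (D : R) : {set 'F_p} :=
  [set x : 'F_p | `[< exists q y : nat,
      [/\ prime q,
          (1 <= q)%N /\ q%:R <= Num.sqrt (p%:R : R),
          (1 <= y)%N /\ y%:R <= D * Num.sqrt p%:R * ln p%:R
        & x = (q * y)%:R] >]]%SET.

(* Main.v *)
(** Let Q be the number of primes q <= m, where m is the integer part of
    p^(1/2), and let Y be the range of y.  For primes q1 <> q2, the congruence
    q1 y1 = q2 y2 (mod p) has at most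
    (Y / q2 + 1) (q2 (q1 + Y) / p + 1) = Y^2 / p + O(Y / q2 + Y / m + 1)
    solutions in y1, y2 <= Y.  Always dividing by the larger prime and summing
    over all pairs gives Q^2 Y^2 / p + O(Q Y) collisions q1 y1 = q2 y2 (mod p),
    so by Cauchy-Schwarz the products q y miss O(p^2 / (Q Y)) classes.
    Chebyshev's bound Q >> p^(1/2) / log p makes this O(p / Delta). *)
Require Import Defs.
From HB Require Import structures.
From mathcomp Require Import all_boot all_order all_algebra.
From mathcomp Require Import all_classical all_reals all_analysis.
From mathcomp Require Import zify ring lra.
Set Implicit Arguments.
Unset Strict Implicit.
Unset Printing Implicit Defensive.
Import Order.TTheory GRing.Theory Num.Theory.
Import numFieldNormedType.Exports.
Local Open Scope ring_scope.

(** * Primes dividing central binomial coefficients *)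

Definition primes_upto (m : nat) : {set 'I_m.+1} :=
  [set q : 'I_m.+1 | prime q]%SET.

(** By Legendre's formula the exponent is the sum over k of floor(2n / q^k) - 2 floor(n / q^k); each
    term is 0 or 1, and it is 0 once q^k > 2n. *)
Lemma logn_central_bin q n : prime q ->
  (logn q 'C(n.*2, n) <= trunc_log q n.*2)%N.
Proof.
move=> q_pr; case: (posnP n) => [->|n_gt0]; first by rewrite bin0 logn1.
have q_gt1 := prime_gt1 q_pr.
have n2_gt0 : (0 < n.*2)%N by rewrite double_gt0.
have Efact := bin_fact (leq_addr n n); rewrite addnK addnn in Efact.
have := congr1 (logn q) Efact.
rewrite !lognM ?muln_gt0 ?fact_gt0 ?bin_gt0 -?addnn ?leq_addr // !logn_fact //.
(* Padding the sum for [n] with zero terms gives both sums the same range. *)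
have -> : (\sum_(1 <= k < n.+1) n %/ q ^ k = \sum_(1 <= k < (n + n).+1) n %/ q ^ k)%N.
  rewrite [RHS](@big_cat_nat _ _ _ n.+1) //=; last by lia.
  rewrite [X in (_ + X)%N]big1_seq ?addn0 // => k /andP[_]; rewrite mem_index_iota => /andP[n_lt _].
  by rewrite divn_small // (ltn_trans n_lt) // ltn_expl.
set t := trunc_log q (n + n)%N => E.
have t_le : (t <= n + n)%N.
  by rewrite ltnW // (leq_trans (ltn_expl t q_gt1)) // trunc_logP // addnn.
have : (\sum_(1 <= k < (n + n).+1) (n + n) %/ q ^ k <=
   \sum_(1 <= k < (n + n).+1) (n %/ q ^ k + n %/ q ^ k + (k <= t)))%N.
  apply: leq_sum => k _; have qk_gt0 : (0 < q ^ k)%N by rewrite expn_gt0 ltnW.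
  rewrite divnD // leq_add2l; case: (leqP k t) => k_t; first exact: leq_b1.
  rewrite leqn0 eqb0 -ltnNge.
  have nn_lt : (n + n < q ^ k)%N.
    by rewrite (leq_trans (trunc_log_ltn _ q_gt1)) // leq_pexp2l // ltnW.
  by rewrite !modn_small //; lia.
rewrite -E !big_split /=.
have -> : (\sum_(1 <= k < (n + n).+1) (k <= t) = t)%N.
  rewrite (@big_cat_nat _ _ _ t.+1) //= [X in (_ + X)%N]big1_seq ?addn0.
    rewrite (eq_big_nat _ _ (F2 := fun => 1%N)) => [|k /andP[_]]; last by rewrite ltnS => ->.
    by rewrite sum_nat_const_nat muln1 subn1.
  by move=> k /andP[_]; rewrite mem_index_iota => /andP[+ _]; rewrite ltnNge => /negbTE ->.
lia.
Qed.

(** C(2n+2, n+1) = 2 C(2n+1, n) >= 2 C(2n, n), so each step at least doubles the value. *)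
Lemma central_bin_ge n : (2 ^ n <= 'C(n.*2, n))%N.
Proof.
elim: n => // n IHn.
have F : ('C(n.+1.*2, n.+1) = 2 * 'C(n.*2.+1, n))%N.
  rewrite doubleS binS mulSn mul1n; congr addn.
  by rewrite -bin_sub; [congr ('C(_, _)); lia | lia].
rewrite F expnS leq_mul2l /=; apply: (leq_trans IHn); apply: leq_bin2l; lia.
Qed.

(** Each prime power in the factorization is at most 2n <= m, and no prime above [m] occurs in
    it. *)
Lemma central_bin_le m n : (n.*2 <= m)%N ->
  ('C(n.*2, n) <= m ^ #|primes_upto m|)%N.
Proof.
move=> n_m; case: (posnP n) => [->|n_gt0].
  by rewrite bin0 expn_gt0; case: m {n_m} => //=; rewrite eq_card0 // => -[[] //] *; rewrite inE.
have C_gt0 : (0 < 'C(n.*2, n))%N by rewrite bin_gt0 -addnn leq_addr.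
have n2_gt0 : (0 < n.*2)%N by rewrite double_gt0.
(* Extending the product over primes up to at least [m] lets it be split at [m]. *)
rewrite -[X in (X <= _)%N](partnT C_gt0) (widen_partn _ (leq_maxr m 'C(n.*2, n))).
rewrite (@big_cat_nat _ _ _ m.+1) //= ?ltnS ?leq_maxl // [X in (_ * X)%N]big1_seq ?muln1.
  rewrite big_mkord (bigID [pred q : 'I_m.+1 | prime q]) /= [X in (_ * X)%N]big1 ?muln1; last first.
    by move=> q /negbTE q_npr; rewrite lognE q_npr.
  rewrite -prod_nat_const; apply: (@leq_trans (\prod_(q in primes_upto m) n.*2)%N).
    rewrite big_mkcond [X in (_ <= X)%N]big_mkcond; apply: leq_prod => q _.
    rewrite !inE /=; case: ifP => // q_pr.
    have q_gt1 := prime_gt1 q_pr.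
    apply: leq_trans (trunc_logP q_gt1 n2_gt0).
    by rewrite leq_pexp2l ?logn_central_bin // ltnW.
  exact: leq_prod.
move=> q /andP[_]; rewrite mem_index_iota => /andP[m_q _].
case q_pr: (prime q); last by rewrite lognE q_pr.
have := logn_central_bin n q_pr.
have -> : trunc_log q n.*2 = 0%N by apply/eqP; rewrite trunc_log_eq0; apply/orP; right; lia.
by rewrite leqn0 => /eqP ->.
Qed.

(** * Solutions of q1 y1 = q2 y2 modulo p *)

Lemma coprime_mod_mulI d m a b : coprime d m ->
  m * a = m * b %[mod d] -> a = b %[mod d].
Proof.
move=> co; wlog b_a : a b / (b <= a)%N => [H E|].
  by case: (leqP b a) => [|/ltnW] le_ab; [exact: H | exact/esym/H].
move=> /eqP; rewrite eqn_mod_dvd ?leq_mul2l ?b_a ?orbT // -mulnBr Gauss_dvdr //.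
by rewrite -eqn_mod_dvd // => /eqP.
Qed.

(* With z = Y - y2, the congruence fixes N = q1 (y1 mod q2) + q2 z modulo p once
   the block y1 / q2 is known; as q1 and q2 are coprime, N then determines y1
   and y2, so the pair (y1 / q2, N / p) encodes the solution. *)
Lemma card_congr_pairs p q1 q2 Y : (0 < p)%N -> (0 < q2)%N -> coprime q1 q2 ->
  (#|[set w : 'I_Y * 'I_Y | q1 * w.1.+1 == q2 * w.2.+1 %[mod p]]%SET|
    <= (Y %/ q2).+1 * ((q2 * (q1 + Y)) %/ p).+1)%N.
Proof.
move=> p_gt0 q2_gt0 co12; set S := finset _.
(* Since [w.2 < Y], the subtraction is never truncated. *)
pose N (w : 'I_Y * 'I_Y) := (q1 * (w.1 %% q2) + q2 * (Y - w.2.+1))%N.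
have N_le w : (N w <= q2 * (q1 + Y))%N.
  have : (w.1 %% q2 < q2)%N by rewrite ltn_pmod.
  by rewrite /N; case: w => a b /=; nia.
pose f (w : 'I_Y * 'I_Y) : 'I_(Y %/ q2).+1 * 'I_((q2 * (q1 + Y)) %/ p).+1 :=
  (inord (w.1 %/ q2), inord (N w %/ p)).
suff f_inj : {in S &, injective f}.
  by rewrite -(card_in_imset f_inj) (leq_trans (max_card _)) // card_prod !card_ord.
(* Adding back the block start completes the first term to [q1 * w.1.+1], which the congruence
   replaces by [q2 * w.2.+1]. *)
have NE w : w \in S -> (N w + q1 * ((w.1 %/ q2) * q2).+1 = q2 * Y %[mod p])%N.
  rewrite inE => /eqP Ew.
  have -> : (N w + q1 * ((w.1 %/ q2) * q2).+1 = q1 * w.1.+1 + q2 * (Y - w.2.+1))%N.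
    by rewrite /N addnAC -mulnDr addnS addnC [(w.1 %% q2 + _)%N]addnC -divn_eq addnC.
  rewrite -modnDml Ew modnDml -mulnDr; congr ((_ * _) %% _)%N.
  by rewrite subnKC.
move=> [a b] [a' b'] wS w'S [/(congr1 val) + /(congr1 val)].
rewrite /= !inordK ?ltnS ?leq_div2r //; try exact/ltnW/ltn_ord.
move=> Eq EN.
have EM : N (a, b) = N (a', b') %[mod p].
  apply/eqP; rewrite -(eqn_modDr (q1 * ((a %/ q2) * q2).+1)) (NE (a, b)) //.
  by rewrite Eq (NE (a', b')).
have {EN EM} : N (a, b) = N (a', b') by rewrite (divn_eq (N (a, b)) p) EN EM -divn_eq.
rewrite /N /= => EN.
(* Modulo [q2] only the [q1] term of [N] survives, and [q1] is invertible there. *)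
have Em : (a %% q2 = a' %% q2)%N.
  rewrite -(modn_mod a) -(modn_mod a').
  apply: (@coprime_mod_mulI _ q1); first by rewrite coprime_sym.
  by have := congr1 (modn^~ q2) EN; rewrite ![(q2 * (_ - _))%N]mulnC !(addnC (q1 * _)%N) !modnMDl.
move: EN; rewrite Em => /addnI/eqP; rewrite eqn_mul2l gtn_eqF //= => /eqP Eb.
congr (_, _); apply: val_inj => /=.
  by rewrite (divn_eq a q2) Eq Em -divn_eq.
by have := ltn_ord b; have := ltn_ord b'; lia.
Qed.

(** Cancelling [q] leaves y1 = y2 (mod p), so y1 and a quotient by [p] determine the pair. *)
Lemma card_congr_pairs_diag p q Y : (0 < p)%N -> coprime p q ->
  (#|[set w : 'I_Y * 'I_Y | q * w.1.+1 == q * w.2.+1 %[mod p]]%SET|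
    <= Y * (Y %/ p).+1)%N.
Proof.
move=> p_gt0 co; set S := finset _.
pose f (w : 'I_Y * 'I_Y) : 'I_Y * 'I_(Y %/ p).+1 := (w.1, inord (w.2 %/ p)).
suff f_inj : {in S &, injective f}.
  by rewrite -(card_in_imset f_inj) (leq_trans (max_card _)) // card_prod !card_ord.
move=> [a b] [a' b']; rewrite !inE /= => /eqP/(coprime_mod_mulI co) E.
move=> /eqP/(coprime_mod_mulI co) E' [Ea /(congr1 val)].
rewrite /= !inordK ?ltnS ?leq_div2r //; try exact/ltnW/ltn_ord.
move=> Eb; move: E'; rewrite -Ea E -[b.+1]add1n -[b'.+1]add1n => /eqP; rewrite eqn_modDl => /eqP Em.
by congr (_, _) => //; apply: val_inj; rewrite /= (divn_eq b p) Eb Em -divn_eq.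
Qed.

(** * Image size from collisions *)

(** The fibre sizes [N x] sum to [#|A|], and their squares sum to the number of collisions. *)
Lemma card_imset_ge (R : realFieldType) (T U : finType) (f : T -> U) (A : {set T}) :
  #|A|%:R ^+ 2 <= #|f @: A|%:R *
    #|[set w : T * T | [&& w.1 \in A, w.2 \in A & f w.1 == f w.2]]%SET|%:R :> R.
Proof.
pose N x := #|A :&: f @^-1: [set x]%SET|.
have EN : (\sum_(x in f @: A) N x = #|A|)%N.
  rewrite -sum1_card (partition_big_imset f) /=; apply: eq_bigr => x _.
  by rewrite sum1_card; apply: eq_card => a; rewrite !inE.
have EN2 : #|[set w : T * T | [&& w.1 \in A, w.2 \in A & f w.1 == f w.2]]%SET|
   = (\sum_(x in f @: A) N x ^ 2)%N.
  set S := finset _.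
  rewrite -sum1_card (partition_big (fun w => f w.1) [in f @: A]) /=; last first.
    by move=> w; rewrite inE => /and3P[wA _ _]; apply: imset_f.
  apply: eq_bigr => x _; rewrite sum1_card -mulnn /N -cardsX.
  apply: eq_card => -[a b]; rewrite finset.in_setX !inE /= unfold_in /= !inE /=.
  by rewrite -!andbA; case: (f a =P x) => [<-|_]; rewrite /= ?andbF ?andbT // [f b == _]eq_sym.
set k := #|f @: A|; set n := #|A|.
(* Cauchy-Schwarz, as nonnegativity of the variance of the fibre sizes N x. *)
have H : 0 <= \sum_(x in f @: A) (k%:R * (N x)%:R - n%:R) ^+ 2 :> R.
  by apply: sumr_ge0 => x _; apply: sqr_ge0.
have {H} : 0 <= k%:R * (k%:R *
    #|[set w : T * T | [&& w.1 \in A, w.2 \in A & f w.1 == f w.2]]%SET|%:R - n%:R ^+ 2) :> R.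
  apply: (le_trans H); rewrite EN2 le_eqVlt; apply/orP; left; apply/eqP.
  transitivity (k%:R ^+ 2 * \sum_(x in f @: A) (N x)%:R ^+ 2
     - 2 * k%:R * n%:R * \sum_(x in f @: A) (N x)%:R + \sum_(x in f @: A) n%:R ^+ 2 : R).
    rewrite !mulr_sumr -sumrB -big_split; apply: eq_bigr => x _ /=; ring.
  rewrite -natr_sum EN sumr_const -/k -mulr_natl natr_sum.
  under [in RHS]eq_bigr do rewrite natrX.
  by rewrite -/n; ring.
(* Cancelling the factor [k] requires [k > 0]; for [k = 0] the set [A] is empty. *)
case: (posnP k) => [/eqP|k_gt0].
  rewrite /k cards_eq0 imset_eq0 => /eqP A0.
  by move=> _; rewrite /n A0 cards0 expr0n /= mulr_ge0.
by rewrite pmulr_rge0 ?ltr0n // subr_ge0.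
Qed.

(** * Counting collisions and missed classes *)

Lemma ler_nat_divn (R : realFieldType) (a b : nat) :
  (a %/ b)%:R <= a%:R / b%:R :> R.
Proof.
case: (posnP b) => [->|b_gt0]; first by rewrite divn0 invr0 mulr0.
by rewrite ler_pdivlMr ?ltr0n // -natrM ler_nat leq_trunc_div.
Qed.

(** In the expanded product bound, [q1 * q2 <= p] reduces the contribution of [q1] to 1, and
    [q2 * m <= p] turns q2 Y / p into Y / m. *)
Lemma card_congr_pairs_le (R : realFieldType) m p q1 q2 Y :
  (m * m <= p)%N -> (0 < q1)%N -> (q1 <= m)%N -> (0 < q2)%N -> (q2 <= m)%N ->
  coprime q1 q2 ->
  #|[set w : 'I_Y * 'I_Y | q1 * w.1.+1 == q2 * w.2.+1 %[mod p]]%SET|%:R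
    <= Y%:R ^+ 2 / p%:R + 2 * (Y%:R / q2%:R) + Y%:R / m%:R + 2 :> R.
Proof.
move=> mp q1_gt0 q1m q2_gt0 q2m co.
have m_gt0 : (0 < m)%N by lia.
have p_gt0 : (0 < p)%N by nia.
have := card_congr_pairs Y p_gt0 q2_gt0 co; rewrite -(ler_nat R) => /le_trans; apply.
rewrite natrM -![in leLHS]natr1.
have q12p : q1%:R * q2%:R <= p%:R :> R by rewrite -natrM ler_nat; nia.
have q2mp : q2%:R * m%:R <= p%:R :> R by rewrite -natrM ler_nat; nia.
have H1 := ler_nat_divn R Y q2.
have H2 := ler_nat_divn R (q2 * (q1 + Y)) p.
have p0 : 0 < p%:R :> R by rewrite ltr0n.
have m0 : 0 < m%:R :> R by rewrite ltr0n.
have q0 : 0 < q2%:R :> R by rewrite ltr0n.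
have Y0 : 0 <= Y%:R :> R by [].
have H3 : ((q2 * (q1 + Y)) %/ p)%:R <= q2%:R * Y%:R / p%:R + 1 :> R.
  apply: (le_trans H2); rewrite natrM natrD mulrDr mulrDl addrC lerD2l.
  by rewrite ler_pdivrMr // mul1r mulrC.
have H4 : q2%:R * Y%:R / p%:R <= Y%:R / m%:R :> R.
  by rewrite ler_pdivrMr // mulrAC ler_pdivlMr // mulrAC mulrC ler_wpM2l.
apply: (le_trans (ler_pM _ _ (lerD H1 (lexx 1)) (lerD H3 (lexx 1)))); rewrite ?addr_ge0 //.
have -> : (Y%:R / q2%:R + 1) * (q2%:R * Y%:R / p%:R + 1 + 1)
  = Y%:R ^+ 2 / p%:R + 2 * (Y%:R / q2%:R) + q2%:R * Y%:R / p%:R + 2 :> R.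
  by field; rewrite !gt_eqF.
by rewrite lerD2r lerD2l.
Qed.

Lemma card_congr_pairs_diag_le (R : realFieldType) p q Y :
  (0 < p)%N -> coprime p q ->
  #|[set w : 'I_Y * 'I_Y | q * w.1.+1 == q * w.2.+1 %[mod p]]%SET|%:R
    <= Y%:R ^+ 2 / p%:R + Y%:R :> R.
Proof.
move=> p_gt0 co.
have := card_congr_pairs_diag Y p_gt0 co; rewrite -(ler_nat R) => /le_trans; apply.
rewrite natrM -natr1 mulrDr mulr1 lerD2r expr2 -mulrA ler_wpM2l //.
exact: ler_nat_divn.
Qed.

(** This trivial count suffices to make the sum of Y / q over the primes r <= q at most Y. *)
Lemma card_primes_le m (q : 'I_m.+1) : (0 < q)%N ->
  (#|[set r in primes_upto m | (r <= q)%N]%SET| <= q)%N.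
Proof.
case: q => -[//|q] /= q_m _; pose f (r : 'I_m.+1) : 'I_q.+1 := inord r.-1.
rewrite -[X in (_ <= X)%N]card_ord -(@card_in_imset _ _ f) ?max_card //.
move=> r s; rewrite !inE => /andP[/prime_gt0 r0 rq] /andP[/prime_gt0 s0 sq].
move=> /(congr1 val); rewrite /= !inordK; try lia.
by move=> E; apply: val_inj => /=; lia.
Qed.

(* The index w.2 : 'I_Y stands for y = w.2 + 1, so that y ranges over 1, ..., Y. *)
Definition prod_class p m Y (w : 'I_m.+1 * 'I_Y) : 'F_p := (w.1 * w.2.+1)%:R.

Lemma eq_natr_Fp p a b : prime p ->
  (a%:R == b%:R :> 'F_p) = (a == b %[mod p]).
Proof. by move=> p_pr; rewrite -val_eqE /= !val_Fp_nat. Qed.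

(** Collisions are grouped by their pair of primes; within a group the two y-indices determine the
    collision. *)
Lemma card_prod_class_collisions p m Y
  (X := finset.setX (primes_upto m) [set: 'I_Y]%SET) : prime p ->
  (#|[set w : ('I_m.+1 * 'I_Y) * ('I_m.+1 * 'I_Y) | [&& w.1 \in X, w.2 \in X &
     prod_class p w.1 == prod_class p w.2]]%SET| <=
   \sum_(q1 in primes_upto m) \sum_(q2 in primes_upto m)
     #|[set w : 'I_Y * 'I_Y | q1 * w.1.+1 == q2 * w.2.+1 %[mod p]]%SET|)%N.
Proof.
move=> p_pr; set S := finset _.
rewrite pair_big /= -sum1_card.
rewrite (partition_big (fun w => (w.1.1, w.2.1))
  (fun q => (q.1 \in primes_upto m) && (q.2 \in primes_upto m))) /=; last first.
  move=> [[q1 y1] [q2 y2]]; rewrite !inE /= => /and3P[].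
  by rewrite !andbT => -> ->.
apply: leq_sum => -[q1 q2] /= _; rewrite sum1_card.
set B := (X in (_ <= #|X|)%N).
pose g (w : ('I_m.+1 * 'I_Y) * ('I_m.+1 * 'I_Y)) := (w.1.2, w.2.2).
rewrite -(@card_in_imset _ _ g).
  apply/subset_leq_card/fintype.subsetP => _ /imsetP[[[r1 y1] [r2 y2]] + ->].
  rewrite unfold_in /= !inE /= => /andP[/and3P[_ _ E] /eqP[<- <-]].
  by rewrite -eq_natr_Fp.
move=> [[r1 y1] [r2 y2]] [[s1 z1] [s2 z2]]; rewrite !unfold_in /=.
by move=> /andP[_ /eqP[-> ->]] /andP[_ /eqP[-> ->]] [-> ->].
Qed.

Lemma sum_collisions_le (R : realFieldType) p m Y : prime p ->
  (0 < m)%N -> (m < p)%N -> (m * m <= p)%N -> (m <= Y)%N ->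
  \sum_(q1 in primes_upto m) \sum_(q2 in primes_upto m)
     #|[set w : 'I_Y * 'I_Y | q1 * w.1.+1 == q2 * w.2.+1 %[mod p]]%SET|%:R <=
  (#|primes_upto m|%:R * Y%:R) ^+ 2 / p%:R + 8 * (#|primes_upto m|%:R * Y%:R) :> R.
Proof.
move=> p_pr m_gt0 m_p mm_p m_Y; have p_gt0 := prime_gt0 p_pr.
set A := primes_upto m; set Q : R := #|A|%:R; set y : R := Y%:R.
have y0 : 0 <= y by [].
have Q0 : 0 <= Q by [].
have pm0 : 0 < m%:R :> R by rewrite ltr0n.
have A_gt0 (q : 'I_m.+1) : q \in A -> (0 < q)%N by rewrite inE => /prime_gt0.
(* The term 2 Y / q2 is charged to the larger prime [r] of the pair. *)
pose low (q r : 'I_m.+1) : R := if (q <= r)%N then 2 * (y / r%:R) else 0.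
have low0 q r : 0 <= low q r by rewrite /low; case: ifP => // _; rewrite mulr_ge0 ?divr_ge0.
have sum_low r : r \in A -> \sum_(q in A) low q r <= 2 * y.
  move=> rA; have r0 := A_gt0 r rA.
  rewrite /low -big_mkcondr /= sumr_const -[leLHS]mulr_natr.
  have -> : #|[pred q in A | (q <= r)%N]| = #|[set q in A | (q <= r)%N]%SET|.
    by apply: eq_card => q; rewrite !inE.
  rewrite -!mulrA ler_wpM2l // ler_piMr //.
  rewrite mulrC ler_pdivrMr ?ltr0n // mul1r ler_nat.
  exact: card_primes_le.
pose T q1 q2 : R := y ^+ 2 / p%:R + (if q1 == q2 then y else 0) + low q1 q2 + low q2 q1
  + y / m%:R + 2.
have y_p : 0 <= y ^+ 2 / p%:R by rewrite divr_ge0 ?exprn_ge0.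
have y_m : 0 <= y / m%:R by rewrite divr_ge0.
apply: (@le_trans _ _ (\sum_(q1 in A) \sum_(q2 in A) T q1 q2)).
  apply: ler_sum => q1 q1A; apply: ler_sum => q2 q2A.
  have q1_pr : prime q1 by move: q1A; rewrite inE.
  have q2_pr : prime q2 by move: q2A; rewrite inE.
  have q1m := ltn_ord q1; have q2m := ltn_ord q2.
  case: (eqVneq q1 q2) => [<-|q12].
    apply: le_trans (card_congr_pairs_diag_le R Y p_gt0 _) _.
      by rewrite prime_coprime // gtnNdvd ?prime_gt0 //; lia.
    rewrite /T eqxx; have := low0 q1 q1; lra.
  have co : coprime q1 q2 by rewrite prime_coprime // dvdn_prime2.
  rewrite /T (negbTE q12); case: (leqP q1 q2) => q12le.
    apply: le_trans (card_congr_pairs_le R Y mm_p _ _ _ _ co) _; rewrite ?prime_gt0 //.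
    have -> : low q1 q2 = 2 * (y / q2%:R) by rewrite /low q12le.
    by have := low0 q2 q1; rewrite -/y; lra.
  (* Swapping the coordinates makes the larger prime the divisor. *)
  set S := finset _.
  have -> : #|S| = #|[set w : 'I_Y * 'I_Y | q2 * w.1.+1 == q1 * w.2.+1 %[mod p]]%SET|.
    pose sw (w : 'I_Y * 'I_Y) := (w.2, w.1).
    have sw_inj : injective sw by move=> [a b] [c d] [-> ->].
    rewrite -(card_imset _ sw_inj); apply: eq_card => -[a b].
    apply/imsetP/idP => [[[c d]]|]; rewrite !inE /=; first by move=> + [-> ->]; rewrite eq_sym.
    by move=> E; exists (b, a); rewrite // inE /= eq_sym.
  rewrite coprime_sym in co.
  apply: le_trans (card_congr_pairs_le R Y mm_p _ _ _ _ co) _; rewrite ?prime_gt0 //.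
  have -> : low q2 q1 = 2 * (y / q1%:R) by rewrite /low ltnW.
  by have := low0 q1 q2; rewrite -/y; lra.
have sum_const (c : R) : \sum_(q in A) c = Q * c by rewrite sumr_const mulr_natl.
have sum_diag q1 : q1 \in A -> \sum_(q2 in A) (if q1 == q2 then y else 0) = y.
  move=> q1A; rewrite (bigD1 q1) //= eqxx big1 ?addr0 // => q2 /andP[_].
  by rewrite eq_sym => /negbTE ->.
have -> : \sum_(q1 in A) \sum_(q2 in A) T q1 q2 = Q ^+ 2 * (y ^+ 2 / p%:R) + Q * y
   + 2 * \sum_(q2 in A) \sum_(q1 in A) low q1 q2 + Q ^+ 2 * (y / m%:R) + 2 * Q ^+ 2.
  under eq_bigr => q1 q1A do rewrite !big_split /= sum_diag // !sum_const.
  rewrite !big_split /= !sum_const [X in _ + X + _ + _ + _]exchange_big /=.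
  by ring.
have S1 : \sum_(q2 in A) \sum_(q1 in A) low q1 q2 <= Q * (2 * y).
  by apply: le_trans (ler_sum _ sum_low) _; rewrite sum_const.
have Qm : Q <= m%:R.
  have := card_primes_le (q := ord_max) m_gt0; rewrite -(ler_nat R) /=.
  by congr (_ <= _); congr (_%:R); apply: eq_card => q; rewrite !inE -ltnS ltn_ord andbT.
have S2 : Q ^+ 2 * (y / m%:R) <= Q * y.
  rewrite expr2 -mulrA ler_wpM2l // mulrCA ler_piMr //.
  by rewrite ler_pdivrMr ?mul1r.
have S3 : Q ^+ 2 <= Q * y.
  by rewrite expr2 ler_wpM2l // (le_trans Qm) // ler_nat.
(* 8 = 1 + 4 + 1 + 2: the diagonal, the two [low] sums, the Y / m terms and the constants 2. *)
rewrite exprMn -[X in _ <= X + _]mulrA; lra.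
Qed.

(** With Z = Q Y and k classes hit, Z^2 <= k (Z^2 / p + 8 Z); multiplying by p / Z gives (p - k) Z
    <= 8 k p <= 8 p^2. *)
Lemma card_missed_le (R : realFieldType) p m Y : prime p ->
  (0 < m)%N -> (m < p)%N -> (m * m <= p)%N -> (m <= Y)%N ->
  (p%:R - #|[set prod_class p w | w in finset.setX (primes_upto m) [set: 'I_Y]]%SET|%:R)
    * (#|primes_upto m|%:R * Y%:R) <= 8 * p%:R ^+ 2 :> R.
Proof.
move=> p_pr m_gt0 m_p mm_p m_Y; set X := finset.setX _ _; set k := #|_|.
have H1 := card_imset_ge R (@prod_class p m Y) X.
have H2 := card_prod_class_collisions m Y p_pr.
have H3 := sum_collisions_le R p_pr m_gt0 m_p mm_p m_Y.
move: H2; rewrite -(ler_nat R) natr_sum /=.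
under eq_bigr do rewrite natr_sum.
move=> /le_trans/(_ H3) {H3} H2.
have EX : #|X|%:R = #|primes_upto m|%:R * Y%:R :> R by rewrite cardsX cardsT card_ord natrM.
rewrite EX in H1; move: H1 H2; rewrite -/X -/k.
set J := #|finset _|%:R; set Z : R := _ * Y%:R => H1 H2.
have Z0 : 0 <= Z by rewrite mulr_ge0.
have kp : k%:R <= p%:R :> R by rewrite ler_nat -[X in (_ <= X)%N](card_Fp p_pr) max_card.
have p0 : 0 < p%:R :> R by rewrite ltr0n prime_gt0.
have k0 : 0 <= k%:R :> R by [].
have H : Z ^+ 2 <= k%:R * (Z ^+ 2 / p%:R + 8 * Z).
  by apply: (le_trans H1); rewrite ler_wpM2l.
have [->|Zn0] := eqVneq Z 0; first by rewrite mulr0 mulr_ge0 ?exprn_ge0.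
have {Z0 Zn0} Z0 : 0 < Z by rewrite lt_neqAle eq_sym Zn0.
have {}H : p%:R * Z <= k%:R * (Z + 8 * p%:R).
  rewrite -(ler_pM2r Z0) -(ler_pM2r (_ : 0 < p%:R^-1)) ?invr_gt0 //.
  apply: le_trans (_ : _ <= k%:R * (Z ^+ 2 / p%:R + 8 * Z)) _.
    by apply: le_trans H; rewrite le_eqVlt; apply/orP; left; apply/eqP; field; rewrite gt_eqF.
  by rewrite le_eqVlt; apply/orP; left; apply/eqP; field; rewrite gt_eqF.
have : k%:R * p%:R <= p%:R ^+ 2 :> R by rewrite expr2 ler_wpM2r // ltW.
lra.
Qed.

(** * Chebyshev's bound and the choice of parameters *)

(** Logarithms of 2^n <= C(2n, n) <= m^pi(m) with n = [m./2]. *)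
Lemma chebyshev_lower (R : realType) m : (0 < m)%N ->
  m./2%:R * ln 2 <= #|primes_upto m|%:R * ln m%:R :> R.
Proof.
move=> m_gt0; have m0 : 0 < m%:R :> R by rewrite ltr0n.
have : (2 ^ m./2 <= m ^ #|primes_upto m|)%N.
  apply: leq_trans (central_bin_ge _) (central_bin_le _).
  by rewrite -[X in (_ <= X)%N]odd_double_half leq_addl.
rewrite -(ler_nat R) !natrX => h; rewrite -ler_ln ?posrE ?exprn_gt0 // in h; move: h.
by rewrite !lnXn // -[leLHS]mulr_natl -[leRHS]mulr_natl.
Qed.

(** This is ln(1 + x) <= x at x = -1/2. *)
Lemma ln2_ge (R : realType) : 1 / 2 <= ln 2 :> R.
Proof.
have := @le_ln1Dx R (- (1 / 2)) _.
have -> : 1 + - (1 / 2) = 2^-1 :> R by field.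
by rewrite lnV ?posrE //; lra.
Qed.

(** 64 = 8 * 8: one factor comes from [card_missed_le], the other from Q Y >= D p / 8. The bound
    [16 <= p] ensures [4 <= s] and [2 <= L]. *)
Lemma card_product_classes_ge (R : realType) (p : nat) (D : R) :
  prime p -> (16 <= p)%N -> 1 <= D ->
  p%:R - #|product_classes p D|%:R <= 64 * D^-1 * p%:R.
Proof.
move=> p_pr p_ge D_ge1; set s : R := Num.sqrt p%:R; set L : R := ln p%:R.
have p0 : 0 < p%:R :> R by rewrite ltr0n prime_gt0.
have s2 : s ^+ 2 = p%:R by rewrite sqr_sqrtr // ltW.
have s0 : 0 <= s by exact: sqrtr_ge0.
have s4 : 4 <= s.
  rewrite -(@ler_pXn2r _ 2) ?nnegrE // s2 -natrX ler_nat; exact: p_ge.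
have spos : 0 < s by lra.
have Ls : L = 2 * ln s by rewrite /L -s2 lnXn // mulr_natl.
have L2 : 2 <= L.
  have : ln 16 <= L by rewrite ler_ln ?posrE // ler_nat.
  have -> : 16 = 2 ^+ 4 :> R by rewrite -natrX.
  by rewrite lnXn // -[ln 2 *+ 4]mulr_natl; have := ln2_ge R; lra.
set m := Num.truncn s; set Y := Num.truncn (D * s * L).
have DsL0 : 0 <= D * s * L by rewrite !mulr_ge0 //; lra.
have /andP[ms sm] : m%:R <= s < m.+1%:R by exact: truncn_itv.
have /andP[YD DY] : Y%:R <= D * s * L < Y.+1%:R by exact: truncn_itv.
have m_gt0 : (0 < m)%N by rewrite truncn_gt0; lra.
have mm_p : (m * m <= p)%N.
  by rewrite -(ler_nat R) natrM -s2 expr2 ler_pM.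
have m_p : (m < p)%N.
  rewrite -(ltr_nat R) (le_lt_trans ms) // -s2 expr2 -[ltLHS]mulr1 ltr_pM2l //.
  by lra.
have m_Y : (m <= Y)%N.
  apply: le_truncn; rewrite mulrAC ler_peMl // -[1]mulr1 ler_pM //; lra.
have := card_missed_le R p_pr m_gt0 m_p mm_p m_Y.
set I := (X in #|X|); set Q : R := #|primes_upto m|%:R => missed.
have sub : I \subset product_classes p D.
  apply/fintype.subsetP => _ /imsetP[[q y] + ->].
  rewrite finset.in_setX => /andP[]; rewrite inE /= => q_pr _.
  rewrite inE; apply: asboolT; exists q, y.+1; split=> //.
    split; first exact: prime_gt0.
    by rewrite (le_trans _ ms) // ler_nat -ltnS ltn_ord.
  by split=> //; rewrite (le_trans _ YD) // ler_nat ltn_ord.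
have {}sub : #|I|%:R <= #|product_classes p D|%:R :> R.
  by rewrite ler_nat subset_leq_card.
have QL : s / 4 <= Q * L.
  have lnm : ln m%:R <= ln s by rewrite ler_ln ?posrE // ltr0n.
  have h : Q * ln m%:R <= Q * ln s by rewrite ler_wpM2l.
  (* [m./2] exceeds s/2 - 1, which is at least s/4 because [4 <= s]. *)
  have n_ge : s / 4 <= m./2%:R.
    have : (m <= m./2 * 2 + 1)%N.
      by rewrite muln2 addnC -[X in (X <= _)%N]odd_double_half leq_add2r leq_b1.
    rewrite -(ler_nat R) natrD natrM; move: sm; rewrite -natr1; lra.
  have h2 : s / 4 * (1 / 2) <= m./2%:R * ln 2.
    by apply: (ler_pM _ _ n_ge (ln2_ge R)); lra.
  by rewrite Ls; have := chebyshev_lower R m_gt0; rewrite -/Q; lra.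
(* Rounding down loses less than 1, at most half of a quantity that is at least 2. *)
have Y_ge : D * s * L / 2 <= Y%:R.
  have : 2 <= D * s * L.
    have : 1 * 4 <= D * s by apply: ler_pM => //; lra.
    move=> h; have : 4 * 2 <= D * s * L by apply: ler_pM => //; lra.
    by lra.
  by move: DY; rewrite -natr1; lra.
have QY : D * p%:R / 8 <= Q * Y%:R.
  have -> : D * p%:R / 8 = D * s / 2 * (s / 4) by rewrite -s2; field.
  apply: le_trans (_ : D * s / 2 * (Q * L) <= _).
    by rewrite ler_wpM2l // !mulr_ge0 //; lra.
  have -> : D * s / 2 * (Q * L) = Q * (D * s * L / 2) by ring.
  by rewrite ler_wpM2l.
have D0 : 0 < D by lra.
apply: (@le_trans _ _ (p%:R - #|I|%:R)); first lra.
set g := p%:R - #|I|%:R in missed *.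
have g0 : 0 <= g by rewrite subr_ge0 ler_nat -[X in (_ <= X)%N](card_Fp p_pr) max_card.
have {missed} : g * (D * p%:R / 8) <= 8 * p%:R ^+ 2.
  by apply: le_trans missed; rewrite ler_wpM2l.
have -> : g * (D * p%:R / 8) = g * D * (p%:R / 8) by ring.
have -> : 8 * p%:R ^+ 2 = 64 * p%:R * (p%:R / 8) :> R by field.
rewrite ler_pM2r; last by lra.
by rewrite -ler_pdivlMr // mulrAC.
Qed.

(** * The asymptotic statement *)

Local Open Scope classical_set_scope.
Local Open Scope ring_scope.

Theorem corollary7 (R : realType) :
  exists C : R, forall Delta : nat -> R,
    Delta p @[p --> primes_oo] --> +oo ->
    \forall p \near primes_oo,
      `| #|product_classes p (Delta p)|%:R - p%:R | <= C * (Delta p)^-1 * p%:R.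
Proof.
exists 64 => Delta Delta_oo.
have Delta_ge1 : \forall p \near primes_oo, 1 <= Delta p by exact: cvgry_ge.
have p_ge16 : \forall p \near primes_oo, (16 <= p)%N.
  by apply: cvg_within; exact: nbhs_infty_ge.
have p_prime : \forall p \near primes_oo, prime p by exact: withinT.
near=> p.
have p_pr : prime p by near: p.
(* There are only [p] classes in all, so the error is the number of missed ones. *)
rewrite distrC ger0_norm; last first.
  by rewrite subr_ge0 ler_nat -[X in (_ <= X)%N](card_Fp p_pr) max_card.
by apply: card_product_classes_ge => //; near: p.
Unshelve. all: by end_near.
Qed.
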